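(* Let $\alpha\in(0,1)$ and $\beta=1-\alpha$. Consider the problem $$ \beta^2 y^2 f f'' = \beta y (f')^2(\beta y+f) + \beta(\alpha-2)\, y f f' + \alpha f^2 (f'-1) \quad \text{in } \mathbb{R}, $$ with the anti-symmetry condition at the origin $$ f(0)=0, \qquad f(-y)= -f(y) \ \text{ for all } y . $$ This problem admits a family of solutions $f$, with $f(y)>0$ for $y>0$, satisfying, for any $A<0$, $$ f(y) = y + A\, y^{m_+} + o(y^{m_+}) \quad \text{as } y\to 0^+, \qquad m_+ = \frac{2\alpha^2-4\alpha+3+\sqrt{(2\alpha^2-4\alpha+3)^2-4(1-\alpha)^4}}{2(1-\alpha)^2}, $$ and $$ f(y) = C_0\, y^{-\frac{\alpha}{1-\alpha}}(1+o(1)) \to 0^+ \quad \text{as } y\to+\infty, $$ where $C_0=C_0(A)>0$ is a constant depending on $A$ (that is, for every $A<0$ there is a solution $f$ of the problem, positive for $y>0$, with these two asymptotic behaviours).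
   Context: The ordinary differential equation arises from looking for blow-up similarity solutions $u_-(x,t)=(-t)^{-\alpha} f(y)$, $y=x/(-t)^{\beta}$, $t<0$, of the PDE $u u_{tt}-(u_t)^2=u u_x u_t$. Primes denote $d/dy$. *)

(* Defs.v *)
(* Built on Stdlib's real numbers and Coquelicot. *)
From Stdlib Require Import Reals.
From Coquelicot Require Import Coquelicot.
Open Scope R_scope.

Definition C2 (f : R -> R) : Prop :=
  (forall (k : nat) (y : R), (k <= 2)%nat -> ex_derive_n f k y) /\
  (forall y : R, continuous (Derive_n f 2) y).

(* The equation degenerates at [y = 0], so regularity there does not follow from
   it; solutions are classical, i.e. of class C^2 on the whole line. *)
Definition similarity_ode (alpha beta : R) (f : R -> R) : Prop :=
  C2 f /\
  forall y : R,
    beta ^ 2 * y ^ 2 * f y * Derive_n f 2 y =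
      beta * y * (Derive f y) ^ 2 * (beta * y + f y)
      + beta * (alpha - 2) * y * f y * Derive f y
      + alpha * (f y) ^ 2 * (Derive f y - 1).

Definition antisymmetric (f : R -> R) : Prop :=
  f 0 = 0 /\ forall y : R, f (- y) = - f y.

Definition m_plus (alpha : R) : R :=
  (2 * alpha ^ 2 - 4 * alpha + 3
   + sqrt ((2 * alpha ^ 2 - 4 * alpha + 3) ^ 2 - 4 * (1 - alpha) ^ 4))
  / (2 * (1 - alpha) ^ 2).

(* In Coquelicot, [is_domin F g h] means [h = o(g)] along the filter [F], and
   [is_equiv F g h] means [g = h (1 + o(1))] along [F]. *)

Definition expansion_at_origin (alpha A : R) (f : R -> R) : Prop :=
  is_domin (at_right 0)
    (fun y : R => Rpower y (m_plus alpha))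
    (fun y : R => f y - (y + A * Rpower y (m_plus alpha))).

Definition decay_at_infinity (alpha C0 : R) (f : R -> R) : Prop :=
  is_equiv (Rbar_locally p_infty)
    f (fun y : R => C0 * Rpower y (- (alpha / (1 - alpha)))) /\
  filterlim f (Rbar_locally p_infty) (at_right 0).

(* Main.v *)
Require Import Defs.
From Stdlib Require Import Reals Lra Lia.
From Coquelicot Require Import Coquelicot.
Open Scope R_scope.

(** The equation is homogeneous: writing [f y = y * g] and [tau = ln y] makes it
    autonomous. With [s = alpha + beta * y * f' / f] it becomes the planar system
    [beta * dg/dtau = - (1 - s) * g], [beta * ds/dtau = - s * (1 - f')], where
    [f' = g * (s - alpha) / beta]. The point [g = s = 1] is the solution [f = y]; it
    is a saddle whose unstable rate [mu] is the positive root of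
    [beta^2 mu^2 = mu + 1], that is [mu = m_+ - 1]. The solutions sought are the
    orbits leaving the saddle along its unstable direction into [g, s < 1]; there
    [g] and [s] decrease to [0], which gives the decay, and a translation of [tau]
    produces every [A < 0].

    With [g = exp (- ell)] and [s = exp (- u)] the second equation integrates once.
    Let [psi x = 1 - exp (- x)] and [j = int psi(ell) dtau], the integral starting
    at [tau = - infinity]. Then [u = (psi(ell) + j) / beta], and the system reads
      [dj/dtau = psi(ell)],  [dell/dtau = psi(u) / beta].
    Since [psi x <= x] and [psi] is 1-Lipschitz for [x >= 0], the right-hand sides
    are dominated on the whole quadrant [ell, j >= 0], together with their Lipschitz
    constants, by the linearization at the saddle. An orbit can therefore be constructed at once for
    all [tau] by Picard iteration from the linear solution [c * y^mu]: the error of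
    the first step is [O(y^(2 mu))], and in the weight [y^(2 mu)] the iteration
    contracts by [1/2] because the linear growth rate is only [mu]. No continuation
    of local solutions is needed ([picard_contraction], [picard_fixed_point]).

    The iteration is done in the variable [z] with [z^2 = c * y^mu], so that weights
    are the polynomials [z^2] and [z^4] and the integrands [g(t) / t] of the measure
    [dtau] vanish at [t = 0]. In terms of [y] the fixed point gives a pair
    [(ell, j)], a [profile]. All derivatives of [f = y * exp (- ell)] are then
    explicit, and [1 - f' = O(y^mu)], [f'' = O(y^(mu - 1))] with [mu > 1] make the
    odd extension of class [C^2] across the degenerate point [y = 0]
    ([sol_similarity_ode]).

    At infinity [ell - ln y / beta] is nonincreasing in [y], its [tau]-derivative
    being [- s / beta], and it is bounded below because [s <= exp (- j / beta)]
    while [dj/dtau] stays away from [0] ([profile_ell_log]). So it converges, and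
    [f = y * exp (- ell)] behaves like a multiple of
    [y^(1 - 1/beta) = y^(- alpha/beta)] ([sol_decay]). *)

(** * The function 1 - exp (- x) *)

Definition psi (x : R) : R := 1 - exp (- x).

Lemma psi_0 : psi 0 = 0.
Proof. unfold psi. rewrite Ropp_0, exp_0. ring. Qed.

Lemma psi_le (x : R) : psi x <= x.
Proof. unfold psi. generalize (exp_ineq1_le (- x)). lra. Qed.

Lemma psi_increasing (x y : R) : x <= y -> psi x <= psi y.
Proof.
  intros [H | ->]; [|lra].
  unfold psi. assert (exp (- y) < exp (- x)) by (apply exp_increasing; lra). lra.
Qed.

Lemma psi_ge0 (x : R) : 0 <= x -> 0 <= psi x.
Proof. intros H. rewrite <- psi_0. now apply psi_increasing. Qed.

Lemma psi_gt0 (x : R) : 0 < x -> 0 < psi x.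
Proof.
  intros H. unfold psi.
  assert (exp (- x) < exp 0) by (apply exp_increasing; lra). rewrite exp_0 in *. lra.
Qed.

Lemma psi_lt1 (x : R) : psi x < 1.
Proof. unfold psi. generalize (exp_pos (- x)). lra. Qed.

(** From [1 + x <= exp x], i.e. [exp (- x) * (1 + x) <= 1]. This bounds the
    error made by linearizing at the saddle. *)
Lemma psi_ge_quadratic (x : R) : 0 <= x -> x - x ^ 2 <= psi x.
Proof.
  intros H.
  assert (H1 : (1 - psi x) * (1 + x) <= 1).
  { replace (1 - psi x) with (exp (- x)) by (unfold psi; ring).
    apply Rle_trans with (exp (- x) * exp x).
    - apply Rmult_le_compat_l; [left; apply exp_pos | apply exp_ineq1_le].
    - rewrite <- exp_plus, Rplus_opp_l, exp_0. lra. }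
  generalize (psi_le x) (psi_ge0 x H). nra.
Qed.

(** By monotonicity one may take [x <= y]; then
    [psi y - psi x = exp (- x) * psi (y - x)], and the first factor is at most [1]. *)
Lemma psi_lipschitz (x y : R) :
  0 <= x -> 0 <= y -> Rabs (psi x - psi y) <= Rabs (x - y).
Proof.
  assert (W : forall a b, 0 <= a -> a <= b -> Rabs (psi a - psi b) <= Rabs (a - b)).
  { intros a b Ha Hab.
    assert (Hi := psi_increasing a b Hab).
    rewrite !Rabs_left1 by lra.
    assert (E : psi b - psi a = (1 - psi a) * psi (b - a)).
    { unfold psi. replace (- b) with (- a + - (b - a)) by ring. rewrite exp_plus. ring. }
    generalize (psi_le (b - a)) (psi_ge0 (b - a)) (psi_ge0 a Ha) (psi_lt1 a). nra. }
  intros Hx Hy. destruct (Rle_dec x y) as [H | H].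
  - now apply W.
  - rewrite Rabs_minus_sym, (Rabs_minus_sym x). apply W; lra.
Qed.

Lemma exp_opp_bounds (x : R) : 0 <= x -> 0 < exp (- x) <= 1.
Proof.
  intros H. split; [apply exp_pos|]. generalize (psi_ge0 x H). unfold psi. lra.
Qed.

(** * Real analysis *)

Lemma derive_nonneg_le (f df : R -> R) (a b : R) :
  a <= b -> (forall x, a <= x <= b -> is_derive f x (df x) /\ 0 <= df x) -> f a <= f b.
Proof.
  intros Hab H.
  destruct (MVT_gen f a b df) as [x [Hx E]].
  - rewrite Rmin_left, Rmax_right by exact Hab. intros x Hx. apply H. lra.
  - rewrite Rmin_left, Rmax_right by exact Hab. intros x Hx.
    apply continuity_pt_filterlim, (ex_derive_continuous (K := R_AbsRing) (V := R_NormedModule)).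
    eexists. apply H, Hx.
  - rewrite Rmin_left, Rmax_right in Hx by exact Hab.
    destruct (H x Hx) as [_ Hd]. nra.
Qed.

Lemma Rpower_small (nu e : R) :
  0 < nu -> 0 < e -> exists d, 0 < d /\ forall y, 0 < y < d -> Rpower y nu < e.
Proof.
  intros Hn He. exists (Rpower e (/ nu)). split; [apply exp_pos|].
  intros y Hy. replace e with (Rpower (Rpower e (/ nu)) nu).
  - now apply Rlt_Rpower_l.
  - rewrite Rpower_mult, Rinv_l by lra. now apply Rpower_1.
Qed.

Lemma locally_pos (y : R) : 0 < y -> locally y (fun x => 0 < x).
Proof. exact (open_gt 0 y). Qed.

(** Gives the continuity of [f''] at the degenerate point. *)
Lemma flat_continuous_at_0 (h : R -> R) (K nu : R) :
  0 < nu -> 0 <= K -> h 0 = 0 ->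
  (forall y, y <> 0 -> Rabs (h y) <= K * Rpower (Rabs y) nu) -> continuous h 0.
Proof.
  intros Hn HK H0 H. apply continuity_pt_filterlim. intros e He.
  destruct (Rpower_small nu (e / (K + 1)) Hn) as [d [Hd Hs]].
  { apply Rdiv_lt_0_compat; lra. }
  exists d. split; [exact Hd|]. intros y [_ Hy]. simpl in *. unfold R_dist in *.
  rewrite H0, Rminus_0_r in *.
  destruct (Req_dec y 0) as [-> | Hy0]; [rewrite H0, Rabs_R0; exact He|].
  specialize (H y Hy0). specialize (Hs (Rabs y) (conj (Rabs_pos_lt y Hy0) Hy)).
  apply (Rmult_lt_compat_r (K + 1)) in Hs; [|lra].
  replace (e / (K + 1) * (K + 1)) with e in Hs by (field; lra).
  assert (0 < Rpower (Rabs y) nu) by apply exp_pos. nra.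
Qed.

Lemma flat_derive_at_0 (h : R -> R) (l K nu : R) :
  0 < nu -> 0 <= K ->
  (forall y, y <> 0 -> Rabs (h y - h 0 - l * y) <= K * (Rabs y * Rpower (Rabs y) nu)) ->
  is_derive h 0 l.
Proof.
  intros Hn HK H. apply is_derive_Reals. intros e He.
  destruct (Rpower_small nu (e / (K + 1)) Hn) as [d [Hd Hs]].
  { apply Rdiv_lt_0_compat; lra. }
  exists (mkposreal d Hd). intros y Hy0 Hy. simpl in Hy.
  rewrite Rplus_0_l. specialize (H y Hy0).
  assert (Ha := Rabs_pos_lt y Hy0). specialize (Hs (Rabs y) (conj Ha Hy)).
  apply (Rmult_lt_compat_r (K + 1)) in Hs; [|lra].
  replace (e / (K + 1) * (K + 1)) with e in Hs by (field; lra).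
  replace ((h y - h 0) / y - l) with ((h y - h 0 - l * y) / y) by (field; exact Hy0).
  rewrite Rabs_div by exact Hy0. apply (Rmult_lt_reg_r (Rabs y)); [exact Ha|].
  replace (Rabs (h y - h 0 - l * y) / Rabs y * Rabs y)
    with (Rabs (h y - h 0 - l * y)) by (field; lra).
  assert (0 < Rpower (Rabs y) nu) by apply exp_pos.
  eapply Rle_lt_trans; [exact H|]. nra.
Qed.

Lemma Rpower_pred (y mu : R) : 0 < y -> Rpower y mu = y * Rpower y (mu - 1).
Proof.
  intros Hy. rewrite <- (Rpower_1 y) at 2 by exact Hy. rewrite <- Rpower_plus. f_equal. ring.
Qed.

Lemma is_derive_reflect (h : R -> R) (y l : R) :
  is_derive h (- y) l -> is_derive (fun x => h (- x)) y (- l).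
Proof.
  intros H. replace (- l) with (-1 * l) by ring.
  apply (is_derive_comp (K := R_AbsRing) (V := R_NormedModule) h (fun x => - x)); [exact H|].
  auto_derive; [exact I | ring].
Qed.

Lemma is_RInt_monomial (C a b : R) (n : nat) :
  is_RInt (fun t => C * t ^ n) a b (C / INR (S n) * (b ^ S n - a ^ S n)).
Proof.
  assert (Hn : INR (S n) <> 0) by (apply not_0_INR; discriminate).
  replace (C / INR (S n) * (b ^ S n - a ^ S n))
    with (minus (C / INR (S n) * b ^ S n) (C / INR (S n) * a ^ S n))
    by (unfold minus, plus, opp; simpl; ring).
  apply (is_RInt_derive (fun t => C / INR (S n) * t ^ S n)).
  - intros t _. auto_derive; [exact I|]. simpl pred. field. exact Hn.
  - intros t _. apply (ex_derive_continuous (K := R_AbsRing) (V := R_NormedModule)). auto_derive. exact I.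
Qed.

(** The sequences [u n - 2 D / 2^n] and [u n + 2 D / 2^n] are adjacent. Naming the
    limit by [Lim_seq] makes it a function of the sequence, hence of a parameter. *)
Lemma geometric_limit (u : nat -> R) (D : R) :
  (forall n, Rabs (u (S n) - u n) <= D * (/ 2) ^ n) ->
  is_lim_seq u (real (Lim_seq u)) /\
  forall n, Rabs (u n - real (Lim_seq u)) <= 2 * D * (/ 2) ^ n.
Proof.
  intros H.
  set (lo := fun n => u n - 2 * D * (/ 2) ^ n).
  set (hi := fun n => u n + 2 * D * (/ 2) ^ n).
  assert (Hgeo : is_lim_seq (fun n => 2 * D * (/ 2) ^ n) 0).
  { replace (Finite 0) with (Rbar_mult (2 * D) 0) by (simpl; f_equal; ring).
    apply is_lim_seq_scal_l, is_lim_seq_geom. rewrite Rabs_pos_eq; lra. }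
  assert (Hlo : forall n, lo n <= lo (S n)).
  { intros n. specialize (H n). apply Rabs_le_between in H. unfold lo. simpl. lra. }
  assert (Hhi : forall n, hi (S n) <= hi n).
  { intros n. specialize (H n). apply Rabs_le_between in H. unfold hi. simpl. lra. }
  assert (Hd : is_lim_seq (fun n => hi n - lo n) 0).
  { apply (is_lim_seq_ext (fun n => 2 * D * (/ 2) ^ n + 2 * D * (/ 2) ^ n)).
    - intros n. unfold hi, lo. ring.
    - replace (Finite 0) with (Finite (0 + 0)) by (f_equal; ring).
      now apply is_lim_seq_plus'. }
  destruct (ex_lim_seq_adj lo hi Hlo Hhi Hd) as [[l Hl] [[l' Hl'] Heq]].
  assert (Hu : is_lim_seq u l).
  { apply (is_lim_seq_ext (fun n => lo n + 2 * D * (/ 2) ^ n)).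
    - intros n. unfold lo. ring.
    - replace (Finite l) with (Finite (l + 0)) by (f_equal; ring).
      now apply is_lim_seq_plus'. }
  assert (Hll : l' = l).
  { rewrite (is_lim_seq_unique _ _ Hl), (is_lim_seq_unique _ _ Hl') in Heq. now injection Heq. }
  rewrite Hll in Hl'. rewrite (is_lim_seq_unique _ _ Hu). split; [exact Hu|].
  intros n. simpl real.
  assert (A1 : lo n <= l) by now apply is_lim_seq_incr_compare.
  assert (A2 : l <= hi n) by now apply is_lim_seq_decr_compare.
  unfold lo, hi in *. apply Rabs_le. lra.
Qed.

Lemma monotone_limit (k : R -> R) (m : R) :
  (forall x y, 1 <= x <= y -> k y <= k x) -> (forall y, 1 <= y -> m <= k y) ->
  exists l, (forall y, 1 <= y -> l <= k y) /\
    forall e, 0 < e -> exists M, 1 <= M /\ forall y, M <= y -> k y < l + e.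
Proof.
  intros Hmono Hm.
  destruct (completeness (fun x => exists y, 1 <= y /\ x = - k y)) as [s [Hub Hlub]].
  - exists (- m). intros x [y [Hy ->]]. specialize (Hm y Hy). lra.
  - exists (- k 1), 1. split; [lra | reflexivity].
  - exists (- s). split.
    + intros y Hy. specialize (Hub (- k y)). assert (- k y <= s) by (apply Hub; now exists y). lra.
    + intros e He.
      destruct (Classical_Prop.classic (exists M, 1 <= M /\ k M < - s + e))
        as [[M [HM Hk]] | Hn].
      * exists M. split; [exact HM|]. intros y Hy. specialize (Hmono M y ltac:(lra)). lra.
      * exfalso. assert (s <= s - e); [|lra].
        apply Hlub. intros x [y [Hy ->]].
        destruct (Rlt_dec (k y) (- s + e)); [|lra]. exfalso. apply Hn. now exists y.
Qed.

(** * Integration against dt/t *)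

(** This is the Lipschitz property in the variable [z^2], for nonnegative functions
    vanishing at [0]. It passes to pointwise limits, is preserved by the operations
    of the iteration, and contains both continuity and the growth bound
    [g z <= C * z^2] that makes [g t / t] integrable at [0]. *)
Definition quad_lip (C : R) (g : R -> R) : Prop :=
  (forall z, 0 <= g z) /\ g 0 = 0 /\
  forall z w, Rabs (g z - g w) <= C * Rabs (z ^ 2 - w ^ 2).

(** Since [z^2] stands for [c * y^mu], this is closeness in the weight [y^(2 mu)],
    in which the iteration contracts. *)
Definition quartic_close (D : R) (g h : R -> R) : Prop :=
  forall z, Rabs (g z - h z) <= D * z ^ 4.

(** The absolute value makes this an even function, so that the bounds [quad_lip] and
    [quartic_close] hold on the whole line; only [z >= 0] matters for the orbit. *)
Definition logint (g : R -> R) (z : R) : R := RInt (fun t => g t / t) 0 (Rabs z).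

Lemma quad_lip_le (C : R) (g : R -> R) (z : R) : quad_lip C g -> g z <= C * z ^ 2.
Proof.
  intros [Hp [H0 Hl]]. specialize (Hl z 0). rewrite H0 in Hl.
  rewrite Rminus_0_r in Hl. rewrite (Rabs_pos_eq (g z)) in Hl by apply Hp.
  rewrite (Rabs_pos_eq (z ^ 2 - 0 ^ 2)) in Hl; [nra | nra].
Qed.

Lemma quad_lip_ge0 (C : R) (g : R -> R) : quad_lip C g -> 0 <= C.
Proof.
  intros H. generalize (quad_lip_le C g 1 H). destruct H as [Hp _]. specialize (Hp 1). nra.
Qed.

Lemma quad_lip_continuous (C : R) (g : R -> R) (z : R) : quad_lip C g -> continuous g z.
Proof.
  intros H. assert (HC := quad_lip_ge0 C g H). destruct H as [_ [_ Hl]].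
  apply continuity_pt_filterlim.
  assert (Hsq : continuity_pt (fun t => C * Rabs (t ^ 2 - z ^ 2)) z).
  { apply continuity_pt_filterlim, (continuous_scal_r C (fun t => Rabs (t ^ 2 - z ^ 2))).
    apply (continuous_comp (fun t => t ^ 2 - z ^ 2) Rabs); [|apply continuous_Rabs].
    apply (ex_derive_continuous (K := R_AbsRing) (V := R_NormedModule)). auto_derive. auto. }
  intros e He. destruct (Hsq e He) as [d [Hd Hd']]. exists d. split; [exact Hd|].
  intros t Ht. specialize (Hd' t Ht). simpl in *. unfold R_dist in *.
  eapply Rle_lt_trans; [|exact Hd'].
  replace (C * Rabs (z * (z * 1) - z * (z * 1))) with 0
    by (rewrite Rminus_diag, Rabs_R0; ring).
  rewrite Rminus_0_r.
  rewrite (Rabs_pos_eq (C * _)) by (apply Rmult_le_pos; [lra | apply Rabs_pos]).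
  apply Hl.
Qed.

(** The value of the quotient at [0] is [0 / 0 = 0], which is also its limit, as
    [|g t / t| <= C * |t|]. *)
Lemma quad_lip_quotient_continuous (C : R) (g : R -> R) (z : R) :
  quad_lip C g -> continuous (fun t => g t / t) z.
Proof.
  intros H. destruct (Req_dec z 0) as [-> | Hz].
  - assert (HC := quad_lip_ge0 C g H).
    apply continuity_pt_filterlim. intros e He.
    exists (e / (C + 1)). split; [apply Rdiv_lt_0_compat; lra|].
    intros t [_ Ht]. simpl in *. unfold R_dist in *.
    replace (g 0 / 0) with 0 by (destruct H as [_ [-> _]]; unfold Rdiv; ring).
    rewrite Rminus_0_r in *.
    destruct (Req_dec t 0) as [-> | Ht0].
    { destruct H as [_ [-> _]]. unfold Rdiv. rewrite Rmult_0_l, Rabs_R0. exact He. }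
    assert (Hb := quad_lip_le C g t H). destruct H as [Hp _]. specialize (Hp t).
    assert (Hta := Rabs_pos_lt t Ht0).
    rewrite Rabs_div by exact Ht0. rewrite (Rabs_pos_eq (g t)) by exact Hp.
    rewrite <- pow2_abs in Hb.
    apply (Rmult_lt_compat_r (C + 1)) in Ht; [|lra].
    replace (e / (C + 1) * (C + 1)) with e in Ht by (field; lra).
    apply (Rmult_lt_reg_r (Rabs t)); [exact Hta|].
    replace (g t / Rabs t * Rabs t) with (g t) by (field; lra).
    nra.
  - apply (continuous_mult g (fun t => / t)).
    + now apply quad_lip_continuous with C.
    + now apply continuous_Rinv.
Qed.

Lemma ex_RInt_quotient (C : R) (g : R -> R) (a b : R) :
  quad_lip C g -> ex_RInt (fun t => g t / t) a b.
Proof.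
  intros H. apply (ex_RInt_continuous (V := R_CompleteNormedModule)).
  intros t _. now apply quad_lip_quotient_continuous with C.
Qed.

Lemma logint_derive (C : R) (g : R -> R) (z : R) :
  quad_lip C g -> 0 < z -> is_derive (logint g) z (g z / z).
Proof.
  intros H Hz.
  apply (is_derive_ext_loc (fun x => RInt (fun t => g t / t) 0 x)).
  - exists (mkposreal z Hz). intros x Hx. unfold logint.
    rewrite Rabs_pos_eq; [reflexivity|].
    unfold ball in Hx; simpl in Hx; unfold AbsRing_ball, minus, plus, opp, abs in Hx; simpl in Hx.
    apply Rabs_def2 in Hx. lra.
  - apply (is_derive_RInt (fun t => g t / t) _ 0 z).
    + exists (mkposreal 1 Rlt_0_1). intros x _.
      apply (RInt_correct (V := R_CompleteNormedModule)). now apply ex_RInt_quotient with C.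
    + now apply quad_lip_quotient_continuous with C.
Qed.

(** Compare [g t / t] with [C * t], whose integral from [w] to [z] is
    [C / 2 * (z^2 - w^2)]. *)
Lemma logint_quad_lip (C : R) (g : R -> R) : quad_lip C g -> quad_lip (C / 2) (logint g).
Proof.
  intros H.
  assert (Hint : forall a b, 0 <= a -> a <= b ->
    0 <= RInt (fun t => g t / t) a b <= C / 2 * (b ^ 2 - a ^ 2)).
  { intros a b Ha Hab. split.
    - apply RInt_ge_0; [exact Hab | now apply ex_RInt_quotient with C |].
      intros t Ht. destruct H as [Hp _]. apply Rdiv_le_0_compat; [apply Hp | lra].
    - change 2 with (INR 2) at 1.
      rewrite <- (is_RInt_unique _ _ _ _ (is_RInt_monomial C a b 1)).
      apply RInt_le; [exact Hab | now apply ex_RInt_quotient with C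
                     | eexists; apply is_RInt_monomial |].
      intros t Ht. assert (Hb := quad_lip_le C g t H).
      apply (Rmult_le_reg_r t); [lra|]. replace (g t / t * t) with (g t) by (field; lra).
      nra. }
  assert (Hdiff : forall a b, 0 <= a -> a <= b ->
    RInt (fun t => g t / t) 0 b - RInt (fun t => g t / t) 0 a = RInt (fun t => g t / t) a b).
  { intros a b Ha Hab.
    rewrite <- (RInt_Chasles (V := R_CompleteNormedModule) _ 0 a b)
      by now apply ex_RInt_quotient with C.
    unfold plus; simpl. ring. }
  repeat split.
  - intros z. apply Hint; [lra | apply Rabs_pos].
  - unfold logint. rewrite Rabs_R0. now rewrite RInt_point.
  - assert (W : forall z w, Rabs w <= Rabs z ->
        Rabs (logint g z - logint g w) <= C / 2 * Rabs (z ^ 2 - w ^ 2)).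
    { intros z w Hzw. unfold logint. rewrite <- (pow2_abs z), <- (pow2_abs w).
      assert (Hw := Rabs_pos w).
      rewrite Hdiff by assumption.
      rewrite (Rabs_pos_eq (RInt _ _ _)) by now apply Hint.
      rewrite (Rabs_pos_eq (Rabs z ^ 2 - Rabs w ^ 2)) by nra.
      now apply Hint. }
    intros z w. destruct (Rle_dec (Rabs w) (Rabs z)) as [Hzw | Hzw]; [now apply W|].
    rewrite Rabs_minus_sym, (Rabs_minus_sym (z ^ 2)). apply W. lra.
Qed.

(** The gain [1/4], against [1/2] in [logint_quad_lip], is what makes the iteration
    contract: higher powers of [t] gain more from integration against [dt/t]. *)
Lemma logint_close (C C' D : R) (g h : R -> R) :
  quad_lip C g -> quad_lip C' h -> quartic_close D g h ->
  quartic_close (D / 4) (logint g) (logint h).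
Proof.
  intros Hg Hh Hc z. unfold logint.
  rewrite <- (RInt_minus (V := R_CompleteNormedModule))
    by (eapply ex_RInt_quotient; eassumption).
  replace (D / 4 * z ^ 4) with (D / INR 4 * (Rabs z ^ 4 - 0 ^ 4)).
  2: { replace (Rabs z ^ 4) with ((Rabs z ^ 2) ^ 2) by ring.
       rewrite pow2_abs. simpl. field. }
  apply (norm_RInt_le (V := R_NormedModule) (fun t => minus (g t / t) (h t / t))
           (fun t => D * t ^ 3) 0 (Rabs z)).
  - apply Rabs_pos.
  - intros t [Ht _]. unfold norm, minus, plus, opp; simpl; unfold abs; simpl.
    destruct Ht as [Ht | <-].
    + replace (g t / t + - (h t / t)) with ((g t - h t) / t) by (field; lra).
      rewrite Rabs_div by lra. rewrite (Rabs_pos_eq t) by lra.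
      apply (Rmult_le_reg_r t); [exact Ht|].
      replace (Rabs (g t - h t) / t * t) with (Rabs (g t - h t)) by (field; lra).
      specialize (Hc t). simpl in Hc. lra.
    + destruct Hg as [_ [-> _]], Hh as [_ [-> _]].
      unfold Rdiv. rewrite Rmult_0_l, Ropp_0, Rplus_0_r, Rabs_R0. lra.
  - apply (RInt_correct (V := R_CompleteNormedModule)).
    apply (ex_RInt_minus (V := R_NormedModule)); eapply ex_RInt_quotient; eassumption.
  - apply is_RInt_monomial.
Qed.

Lemma logint_square (C z : R) : logint (fun t => C * t ^ 2) z = C / 2 * z ^ 2.
Proof.
  unfold logint. rewrite (RInt_ext _ (fun t => C * t ^ 1)).
  - rewrite (is_RInt_unique _ _ _ _ (is_RInt_monomial C 0 (Rabs z) 1)), pow2_abs.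
    simpl. field.
  - rewrite Rmin_left, Rmax_right by apply Rabs_pos.
    intros t Ht. simpl. field. lra.
Qed.

(** * Quadratically Lipschitz functions *)

Lemma square_quad_lip (C : R) : 0 <= C -> quad_lip C (fun z => C * z ^ 2).
Proof.
  intros H. repeat split.
  - intros z. nra.
  - ring.
  - intros z w. replace (C * z ^ 2 - C * w ^ 2) with (C * (z ^ 2 - w ^ 2)) by ring.
    rewrite Rabs_mult, (Rabs_pos_eq C H). lra.
Qed.

Lemma psi_quad_lip (C : R) (g : R -> R) : quad_lip C g -> quad_lip C (fun z => psi (g z)).
Proof.
  intros [Hp [H0 Hl]]. repeat split.
  - intros z. apply psi_ge0, Hp.
  - rewrite H0. apply psi_0.
  - intros z w. eapply Rle_trans; [now apply psi_lipschitz | apply Hl].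
Qed.

Lemma psi_close (C C' D : R) (g h : R -> R) :
  quad_lip C g -> quad_lip C' h -> quartic_close D g h ->
  quartic_close D (fun z => psi (g z)) (fun z => psi (h z)).
Proof.
  intros [Hg _] [Hh _] H z. eapply Rle_trans; [now apply psi_lipschitz | apply H].
Qed.

(** Replacing [psi x] by [x] costs [x^2], which is of fourth order in [z]. *)
Lemma psi_close_id (C D : R) (g h : R -> R) :
  quad_lip C g -> quartic_close D g h ->
  quartic_close (D + C ^ 2) (fun z => psi (g z)) h.
Proof.
  intros Hg H z. specialize (H z).
  assert (Hb := quad_lip_le C g z Hg). assert (HC := quad_lip_ge0 C g Hg).
  destruct Hg as [Hp _]. specialize (Hp z).
  replace (psi (g z) - h z) with ((psi (g z) - g z) + (g z - h z)) by ring.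
  eapply Rle_trans; [apply Rabs_triang|].
  assert (Rabs (psi (g z) - g z) <= C ^ 2 * z ^ 4); [|nra].
  rewrite Rabs_left1 by (generalize (psi_le (g z)); lra).
  generalize (psi_ge_quadratic (g z) Hp); nra.
Qed.

Lemma scal_quad_lip (k C : R) (g : R -> R) :
  0 <= k -> quad_lip C g -> quad_lip (k * C) (fun z => k * g z).
Proof.
  intros Hk [Hp [H0 Hl]]. repeat split.
  - intros z. apply Rmult_le_pos; [exact Hk | apply Hp].
  - rewrite H0. ring.
  - intros z w. rewrite <- Rmult_minus_distr_l, Rabs_mult, (Rabs_pos_eq k Hk), Rmult_assoc.
    now apply Rmult_le_compat_l.
Qed.

Lemma plus_quad_lip (C C' : R) (g h : R -> R) :
  quad_lip C g -> quad_lip C' h -> quad_lip (C + C') (fun z => g z + h z).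
Proof.
  intros [Hp [H0 Hl]] [Hp' [H0' Hl']]. repeat split.
  - intros z. specialize (Hp z). specialize (Hp' z). lra.
  - rewrite H0, H0'. ring.
  - intros z w. replace (g z + h z - (g w + h w)) with ((g z - g w) + (h z - h w)) by ring.
    eapply Rle_trans; [apply Rabs_triang|]. specialize (Hl z w). specialize (Hl' z w). lra.
Qed.

Lemma scal_close (k D : R) (g h : R -> R) :
  0 <= k -> quartic_close D g h -> quartic_close (k * D) (fun z => k * g z) (fun z => k * h z).
Proof.
  intros Hk H z. rewrite <- Rmult_minus_distr_l, Rabs_mult, (Rabs_pos_eq k Hk), Rmult_assoc.
  now apply Rmult_le_compat_l.
Qed.

Lemma plus_close (D D' : R) (g h g' h' : R -> R) :
  quartic_close D g h -> quartic_close D' g' h' ->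
  quartic_close (D + D') (fun z => g z + g' z) (fun z => h z + h' z).
Proof.
  intros H H' z. replace (g z + g' z - (h z + h' z)) with ((g z - h z) + (g' z - h' z)) by ring.
  eapply Rle_trans; [apply Rabs_triang|]. specialize (H z). specialize (H' z). lra.
Qed.

(** * The fixed point *)

(** The quantity [u = (psi(ell) + j) / beta] as a function of [z]. As
    [z^2 = c * y^mu], one has [dy/y = (2 / mu) * dz/z], whence the factor. *)
Definition drift (beta mu : R) (L : R -> R) (z : R) : R :=
  / beta * (psi (L z) + 2 / mu * logint (fun t => psi (L t)) z).

(** Integral form of [dell/dtau = psi(u) / beta]. *)
Definition picard (beta mu : R) (L : R -> R) (z : R) : R :=
  2 / (mu * beta) * logint (fun t => psi (drift beta mu L t)) z.

Lemma drift_quad_lip (beta mu C : R) (L : R -> R) :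
  0 < beta -> 0 < mu -> quad_lip C L ->
  quad_lip (/ beta * (C + 2 / mu * (C / 2))) (drift beta mu L).
Proof.
  intros Hb Hm H.
  assert (0 <= / beta) by (left; now apply Rinv_0_lt_compat).
  assert (0 <= 2 / mu) by (apply Rdiv_le_0_compat; lra).
  unfold drift. apply scal_quad_lip; [assumption|].
  apply plus_quad_lip; [now apply psi_quad_lip|].
  apply scal_quad_lip; [assumption|]. now apply logint_quad_lip, psi_quad_lip.
Qed.

(** The constant [1] is reproduced exactly: bounding [psi x] by [x] turns the map
    into its linearization, for which [z^2] is a fixed point, by the equation of
    [mu]. *)
Lemma picard_quad_lip (beta mu : R) (L : R -> R) :
  0 < beta -> 0 < mu -> beta ^ 2 * mu ^ 2 = mu + 1 ->
  quad_lip 1 L -> quad_lip 1 (picard beta mu L).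
Proof.
  intros Hb Hm E H.
  assert (0 <= 2 / (mu * beta)) by (apply Rdiv_le_0_compat; nra).
  (* The constant of the linearized map; it equals 1 by the equation of mu. *)
  replace 1 with (2 / (mu * beta) * ((/ beta * (1 + 2 / mu * (1 / 2))) / 2)).
  2: { replace (2 / (mu * beta) * ((/ beta * (1 + 2 / mu * (1 / 2))) / 2))
         with ((mu + 1) / (beta ^ 2 * mu ^ 2)) by (field; lra).
       rewrite E. field. lra. }
  unfold picard. apply scal_quad_lip; [assumption|].
  now apply logint_quad_lip, psi_quad_lip, drift_quad_lip.
Qed.

(** Each integration against [dt/t] divides a quartic bound by [4]; by the equation
    of [mu] the resulting factor is [(mu + 1/2) / (2 * (mu + 1)) < 1/2]. *)
Lemma picard_contraction (beta mu D : R) (L M : R -> R) :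
  0 < beta -> 0 < mu -> beta ^ 2 * mu ^ 2 = mu + 1 -> 0 <= D ->
  quad_lip 1 L -> quad_lip 1 M -> quartic_close D L M ->
  quartic_close (D / 2) (picard beta mu L) (picard beta mu M).
Proof.
  intros Hb Hm E HD HL HM H.
  assert (0 <= / beta) by (left; now apply Rinv_0_lt_compat).
  assert (0 <= 2 / mu) by (apply Rdiv_le_0_compat; lra).
  assert (0 <= 2 / (mu * beta)) by (apply Rdiv_le_0_compat; nra).
  assert (Hc : quartic_close (2 / (mu * beta) * (/ beta * (D + 2 / mu * (D / 4)) / 4))
                 (picard beta mu L) (picard beta mu M)).
  { unfold picard. apply scal_close; [assumption|].
    eapply logint_close; [now apply psi_quad_lip, drift_quad_lip, HL
                         | now apply psi_quad_lip, drift_quad_lip, HM |].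
    eapply psi_close; [now apply drift_quad_lip, HL | now apply drift_quad_lip, HM |].
    unfold drift. apply scal_close; [assumption|].
    apply plus_close; [eapply psi_close; eassumption|].
    apply scal_close; [assumption|].
    eapply logint_close; [apply psi_quad_lip, HL | apply psi_quad_lip, HM |].
    eapply psi_close; eassumption. }
  intros z. eapply Rle_trans; [apply Hc|].
  apply Rmult_le_compat_r; [replace (z ^ 4) with ((z ^ 2) ^ 2) by ring; apply pow2_ge_0|].
  replace (2 / (mu * beta) * (/ beta * (D + 2 / mu * (D / 4)) / 4))
    with (D / 2 * ((mu + / 2) / (beta ^ 2 * mu ^ 2))) by (field; lra).
  rewrite E. rewrite <- (Rmult_1_r (D / 2)) at 2.
  apply Rmult_le_compat_l; [lra|]. apply (Rmult_le_reg_r (mu + 1)); [lra|].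
  replace ((mu + / 2) / (mu + 1) * (mu + 1)) with (mu + / 2) by (field; lra). lra.
Qed.

(** [z^2] is fixed by the linearized map, so the error comes only from replacing
    [psi x] by [x] twice. *)
Lemma picard_first_step (beta mu : R) :
  0 < beta -> 0 < mu -> beta ^ 2 * mu ^ 2 = mu + 1 ->
  exists D, 0 <= D /\
    quartic_close D (picard beta mu (fun z => 1 * z ^ 2)) (fun z => 1 * z ^ 2).
Proof.
  intros Hb Hm E.
  assert (0 <= / beta) by (left; now apply Rinv_0_lt_compat).
  assert (0 <= 2 / mu) by (apply Rdiv_le_0_compat; lra).
  assert (0 <= 2 / (mu * beta)) by (apply Rdiv_le_0_compat; nra).
  assert (HS : quad_lip 1 (fun z => 1 * z ^ 2)) by (apply square_quad_lip; lra).
  set (K := / beta * (1 + 2 / mu * (1 / 2))).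
  assert (HK : quad_lip K (drift beta mu (fun z => 1 * z ^ 2))) by now apply drift_quad_lip.
  assert (Hpsi : quartic_close 1 (fun z => psi (1 * z ^ 2)) (fun z => 1 * z ^ 2)).
  { replace 1 with (0 + 1 ^ 2) at 1 by ring. apply psi_close_id; [exact HS|].
    intros z. rewrite Rminus_diag, Rabs_R0. lra. }
  set (D1 := / beta * (1 + 2 / mu * (1 / 4))).
  assert (Hdrift : quartic_close D1 (drift beta mu (fun z => 1 * z ^ 2)) (fun z => K * z ^ 2)).
  { intros z.
    replace (K * z ^ 2) with (/ beta * (1 * z ^ 2 + 2 / mu * logint (fun t => 1 * t ^ 2) z))
      by (rewrite logint_square; unfold K; ring).
    revert z. unfold drift. apply scal_close; [assumption|].
    apply plus_close; [exact Hpsi|]. apply scal_close; [assumption|].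
    eapply logint_close; [apply psi_quad_lip, HS | exact HS | exact Hpsi]. }
  assert (HK0 := quad_lip_ge0 _ _ HK).
  assert (HD1 : 0 <= D1).
  { specialize (Hdrift 1). generalize (Rabs_pos (drift beta mu (fun z => 1 * z ^ 2) 1 - K * 1 ^ 2)). nra. }
  exists (2 / (mu * beta) * ((D1 + K ^ 2) / 4)). split.
  { apply Rmult_le_pos; [assumption|]. nra. }
  intros z.
  replace (1 * z ^ 2) with (2 / (mu * beta) * logint (fun t => K * t ^ 2) z).
  2: { rewrite logint_square. unfold K.
       replace (2 / (mu * beta) * (/ beta * (1 + 2 / mu * (1 / 2)) / 2 * z ^ 2))
         with ((mu + 1) / (beta ^ 2 * mu ^ 2) * z ^ 2) by (field; lra).
       rewrite E. field. lra. }
  revert z. unfold picard. apply scal_close; [assumption|].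
  eapply logint_close; [apply psi_quad_lip, HK | now apply square_quad_lip |].
  now apply psi_close_id.
Qed.

(** Successive iterates differ by [D * z^4 / 2^n], so they converge pointwise, and
    the limit is again in the class. It is a fixed point by the contraction estimate
    between the limit and the iterates. *)
Lemma picard_fixed_point (beta mu : R) :
  0 < beta -> 0 < mu -> beta ^ 2 * mu ^ 2 = mu + 1 ->
  exists (L : R -> R) (D : R),
    quad_lip 1 L /\ (forall z, picard beta mu L z = L z) /\
    quartic_close D L (fun z => z ^ 2).
Proof.
  intros Hb Hm E.
  destruct (picard_first_step beta mu Hb Hm E) as [D [HD Hfirst]].
  set (it := fix it (n : nat) : R -> R :=
    match n with O => fun z => 1 * z ^ 2 | S n => picard beta mu (it n) end).
  assert (Hit : forall n, quad_lip 1 (it n)).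
  { induction n as [|n IH]; [apply square_quad_lip; lra | now apply picard_quad_lip]. }
  assert (Hstep : forall n, quartic_close (D * (/ 2) ^ n) (it (S n)) (it n)).
  { induction n as [|n IH].
    - simpl pow. rewrite Rmult_1_r. exact Hfirst.
    - replace (D * (/ 2) ^ S n) with (D * (/ 2) ^ n / 2) by (simpl; field).
      apply (picard_contraction beta mu _ (it (S n)) (it n)); auto.
      apply Rmult_le_pos; [exact HD | apply pow_le; lra]. }
  set (L := fun z => real (Lim_seq (fun n => it n z))).
  assert (Hlim : forall z, is_lim_seq (fun n => it n z) (L z) /\
            forall n, Rabs (it n z - L z) <= 2 * (D * z ^ 4) * (/ 2) ^ n).
  { intros z. apply geometric_limit. intros n. specialize (Hstep n z). nra. }
  assert (HL : quad_lip 1 L).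
  { repeat split.
    - intros z. apply (is_lim_seq_le (fun _ => 0) (fun n => it n z) 0 (L z)).
      + intros n. apply Hit.
      + apply is_lim_seq_const.
      + apply Hlim.
    - unfold L. rewrite (Lim_seq_ext _ (fun _ => 0)); [now rewrite Lim_seq_const|].
      intros n. apply Hit.
    - intros z w.
      apply (is_lim_seq_le (fun n => Rabs (it n z - it n w))
               (fun _ => 1 * Rabs (z ^ 2 - w ^ 2)) (Rabs (L z - L w))
               (1 * Rabs (z ^ 2 - w ^ 2))).
      + intros n. apply Hit.
      + apply (is_lim_seq_abs _ (Finite (L z - L w))). apply is_lim_seq_minus'; apply Hlim.
      + apply is_lim_seq_const. }
  assert (Hclose : forall n, quartic_close (2 * D * (/ 2) ^ n) (it n) L).
  { intros n z. destruct (Hlim z) as [_ Hz]. specialize (Hz n). nra. }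
  exists L, (2 * D). split; [exact HL|]. split.
  - intros z. symmetry.
    assert (H1 : is_lim_seq (fun n => it (S n) z) (L z)).
    { apply (is_lim_seq_incr_1 (fun n => it n z)). apply Hlim. }
    assert (H2 : is_lim_seq (fun n => it (S n) z) (picard beta mu L z)).
    { apply is_lim_seq_spec. intros e.
      assert (Hg : is_lim_seq (fun n => D * z ^ 4 * (/ 2) ^ n) 0).
      { replace (Finite 0) with (Rbar_mult (D * z ^ 4) 0) by (simpl; f_equal; ring).
        apply is_lim_seq_scal_l, is_lim_seq_geom. rewrite Rabs_pos_eq; lra. }
      apply is_lim_seq_spec in Hg. destruct (Hg e) as [N HN]. exists N. intros n Hn.
      specialize (HN n Hn). rewrite Rminus_0_r in HN.
      eapply Rle_lt_trans; [|exact HN].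
      assert (Hc : quartic_close (2 * D * (/ 2) ^ n / 2)
                     (picard beta mu (it n)) (picard beta mu L)).
      { apply picard_contraction; auto.
        apply Rmult_le_pos; [lra | apply pow_le; lra]. }
      eapply Rle_trans; [apply Hc | eapply Rle_trans; [|apply Rle_abs]]. right. field. }
    apply is_lim_seq_unique in H1. apply is_lim_seq_unique in H2.
    rewrite H1 in H2. now injection H2.
  - intros z. specialize (Hclose 0%nat z). simpl in Hclose. simpl.
    rewrite Rabs_minus_sym.  replace (z * (z * 1)) with (1 * (z * (z * 1))) at 1 by ring.
    eapply Rle_trans; [exact Hclose|]. right; ring.
Qed.

(** * The orbit as a function of y *)

(** The quantity [u] of the planar system, as a function of [y]: for the solution,
    [exp (- u) = alpha + beta * y * f' / f]. *)
Definition exponent (beta : R) (ell j : R -> R) (y : R) : R := / beta * (psi (ell y) + j y).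

(** An orbit on the unstable manifold, with the quantitative information at the
    saddle that regularity at [0] and the expansion require. The values at [0] matter
    for the odd extension. *)
Record profile (beta mu c K : R) (ell j : R -> R) : Prop := Profile {
  profile_ell_0 : ell 0 = 0;
  profile_j_0 : j 0 = 0;
  profile_ell_derive : forall y, 0 < y ->
    is_derive ell y (psi (exponent beta ell j y) / (beta * y));
  profile_j_derive : forall y, 0 < y -> is_derive j y (psi (ell y) / y);
  profile_ell_pos : forall y, 0 < y -> 0 < ell y;
  profile_j_ge0 : forall y, 0 < y -> 0 <= j y;
  profile_ell_le : forall y, 0 < y -> ell y <= c * Rpower y mu;
  profile_j_le : forall y, 0 < y -> j y <= c * Rpower y mu;
  profile_ell_expansion : forall y, 0 < y ->
    Rabs (ell y - c * Rpower y mu) <= K * Rpower y mu ^ 2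
}.

Lemma fixed_point_derive (beta mu : R) (L : R -> R) (z : R) :
  0 < beta -> 0 < mu -> quad_lip 1 L -> (forall z, picard beta mu L z = L z) -> 0 < z ->
  is_derive L z (2 / (mu * beta) * (psi (drift beta mu L z) / z)).
Proof.
  intros Hb Hm HL Hfix Hz.
  apply (is_derive_ext (picard beta mu L)); [exact Hfix|].
  unfold picard. apply is_derive_scal.
  eapply (logint_derive _ (fun t => psi (drift beta mu L t))); [|exact Hz].
  apply psi_quad_lip, drift_quad_lip; eassumption.
Qed.

(** Substitute [z = sqrt c * y^(mu/2)] in the fixed point. Positivity of [ell] for
    small [y] follows from the expansion, and then for all [y] by monotonicity. *)
Lemma profile_exists (beta mu c : R) :
  0 < beta -> 1 < mu -> beta ^ 2 * mu ^ 2 = mu + 1 -> 0 < c ->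
  exists (ell j : R -> R) (K : R), 0 <= K /\ profile beta mu c K ell j.
Proof.
  intros Hb Hm E Hc.
  destruct (picard_fixed_point beta mu Hb ltac:(lra) E) as [L [D [HL [Hfix HD]]]].
  assert (HD0 : 0 <= D).
  { specialize (HD 1). generalize (Rabs_pos (L 1 - 1 ^ 2)). lra. }
  set (rad := fun y => if Rle_dec y 0 then 0 else sqrt c * Rpower y (mu / 2)).
  assert (Hsc : 0 < sqrt c) by now apply sqrt_lt_R0.
  assert (Erad : forall y, 0 < y -> rad y = sqrt c * Rpower y (mu / 2)).
  { intros y Hy. unfold rad. destruct (Rle_dec y 0); [lra | reflexivity]. }
  assert (Hrad : forall y, 0 < y -> 0 < rad y).
  { intros y Hy. rewrite Erad by exact Hy. apply Rmult_lt_0_compat; [exact Hsc | apply exp_pos]. }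
  assert (Hrad2 : forall y, 0 < y -> rad y ^ 2 = c * Rpower y mu).
  { intros y Hy. rewrite Erad by exact Hy. rewrite Rpow_mult_distr, pow2_sqrt by lra.
    simpl. rewrite Rmult_1_r, <- Rpower_plus. do 2 f_equal. field. }
  assert (Hrad_d : forall y, 0 < y -> is_derive rad y (mu / 2 * (rad y / y))).
  { intros y Hy. apply (is_derive_ext_loc (fun x => sqrt c * exp (mu / 2 * ln x))).
    - apply (filter_imp (fun x => 0 < x)); [|now apply locally_pos].
      intros x Hx. now rewrite Erad.
    - auto_derive; [exact Hy|]. rewrite Erad by exact Hy. unfold Rpower. field. lra. }
  assert (Hpsi := psi_quad_lip 1 L HL).
  set (ell := fun y => L (rad y)).
  set (j := fun y => 2 / mu * logint (fun t => psi (L t)) (rad y)).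
  assert (Hjz : quad_lip (2 / mu * (1 / 2)) (fun z => 2 / mu * logint (fun t => psi (L t)) z)).
  { apply scal_quad_lip; [apply Rdiv_le_0_compat; lra|]. now apply logint_quad_lip. }
  assert (Hrad0 : rad 0 = 0).
  { unfold rad. destruct (Rle_dec 0 0); [reflexivity | lra]. }
  assert (Hell_d : forall y, 0 < y ->
            is_derive ell y (psi (exponent beta ell j y) / (beta * y))).
  { intros y Hy.
    replace (psi (exponent beta ell j y) / (beta * y))
      with (mu / 2 * (rad y / y) * (2 / (mu * beta) * (psi (drift beta mu L (rad y)) / rad y))).
    - apply (is_derive_comp (K := R_AbsRing) (V := R_NormedModule) L rad); [|now apply Hrad_d].
      apply fixed_point_derive; auto; lra.
    - change (drift beta mu L (rad y)) with (exponent beta ell j y).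
      specialize (Hrad y Hy). field. lra. }
  assert (Hj_d : forall y, 0 < y -> is_derive j y (psi (ell y) / y)).
  { intros y Hy. unfold j.
    replace (psi (ell y) / y)
      with (2 / mu * (mu / 2 * (rad y / y) * (psi (L (rad y)) / rad y))).
    - apply is_derive_scal.
      apply (is_derive_comp (K := R_AbsRing) (V := R_NormedModule)
               (logint (fun t => psi (L t))) rad); [|now apply Hrad_d].
      eapply (logint_derive _ (fun t => psi (L t))); [exact Hpsi | now apply Hrad].
    - specialize (Hrad y Hy). unfold ell. field. lra. }
  assert (Hj_ge : forall y, 0 <= j y) by (intros y; apply Hjz).
  assert (Hell_ge : forall y, 0 <= ell y) by (intros y; apply HL).
  assert (Hexp : forall y, 0 < y ->
            Rabs (ell y - c * Rpower y mu) <= D * c ^ 2 * Rpower y mu ^ 2).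
  { intros y Hy. specialize (HD (rad y)).
    replace (D * c ^ 2 * Rpower y mu ^ 2) with (D * (c * Rpower y mu) ^ 2) by ring.
    rewrite <- Hrad2 by exact Hy. eapply Rle_trans; [exact HD|]. right; ring. }
  exists ell, j, (D * c ^ 2). split; [apply Rmult_le_pos; [lra | apply pow2_ge_0]|].
  split; auto.
  - unfold ell. rewrite Hrad0. apply HL.
  - unfold j. rewrite Hrad0. apply Hjz.
  - intros y Hy.
    assert (HK : 0 <= D * c ^ 2) by (apply Rmult_le_pos; [lra | apply pow2_ge_0]).
    (* With K = D * c^2: where y^mu < c / (K + 1), the term c * y^mu of the expansion
       dominates the error K * y^(2 mu). *)
    destruct (Rpower_small mu (c / (D * c ^ 2 + 1)) ltac:(lra)) as [d [Hd Hsmall]].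
    { apply Rdiv_lt_0_compat; lra. }
    assert (Hd' : 0 < Rmin d y) by now apply Rmin_glb_lt.
    set (y0 := Rmin d y / 2).
    assert (Hy0 : 0 < y0 < d /\ y0 <= y).
    { unfold y0. generalize (Rmin_l d y) (Rmin_r d y). lra. }
    apply Rlt_le_trans with (ell y0).
    + specialize (Hsmall y0 ltac:(lra)). specialize (Hexp y0 ltac:(lra)).
      assert (HP : 0 < Rpower y0 mu) by apply exp_pos.
      apply Rabs_le_between in Hexp.
      apply (Rmult_lt_compat_r (D * c ^ 2 + 1)) in Hsmall; [|lra].
      replace (c / (D * c ^ 2 + 1) * (D * c ^ 2 + 1)) with c in Hsmall by (field; lra).
      set (P := Rpower y0 mu) in *. set (k := D * c ^ 2) in *. nra.
    + apply (derive_nonneg_le ell (fun y => psi (exponent beta ell j y) / (beta * y))); [lra|].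
      intros x Hx. split; [apply Hell_d; lra|].
      apply Rdiv_le_0_compat; [|apply Rmult_lt_0_compat; lra].
      apply psi_ge0. unfold exponent. apply Rmult_le_pos; [left; now apply Rinv_0_lt_compat|].
      specialize (Hj_ge x). generalize (psi_ge0 (ell x) (Hell_ge x)). lra.
  - intros y Hy. rewrite <- Hrad2 by exact Hy.
    rewrite <- (Rmult_1_l (rad y ^ 2)). exact (quad_lip_le 1 L (rad y) HL).
  - intros y Hy. rewrite <- Hrad2 by exact Hy.
    eapply Rle_trans; [apply (quad_lip_le _ _ (rad y) Hjz)|].
    rewrite <- (Rmult_1_l (rad y ^ 2)) at 2.
    apply Rmult_le_compat_r; [apply pow2_ge_0|].
    replace (2 / mu * (1 / 2)) with (/ mu) by (field; lra).
    rewrite <- Rinv_1. apply Rinv_le_contravar; lra.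
Qed.

(** * The odd solution and its derivatives *)

Definition sol (ell : R -> R) (y : R) : R := y * exp (- ell (Rabs y)).

(** The first derivative [f' = g * (s - alpha) / beta], with [alpha = 1 - beta]. *)
Definition sol1 (beta : R) (ell j : R -> R) (y : R) : R :=
  exp (- ell (Rabs y)) * (exp (- exponent beta ell j (Rabs y)) - (1 - beta)) / beta.

(** The second derivative, from [y * ell' = (1 - s) / beta] and
    [y * u' = (1 - f') / beta]. At [y = 0] division by zero yields the right
    value [0]. *)
Definition sol2 (beta : R) (ell j : R -> R) (y : R) : R :=
  - (psi (exponent beta ell j (Rabs y)) / beta * sol1 beta ell j y
     + exp (- ell (Rabs y)) * exp (- exponent beta ell j (Rabs y))
       * (1 - sol1 beta ell j y) / beta ^ 2) / y.

Lemma sol_odd (ell : R -> R) (y : R) : sol ell (- y) = - sol ell y.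
Proof. unfold sol. rewrite Rabs_Ropp. ring. Qed.

Lemma sol1_even (beta : R) (ell j : R -> R) (y : R) :
  sol1 beta ell j (- y) = sol1 beta ell j y.
Proof. unfold sol1. now rewrite Rabs_Ropp. Qed.

Lemma sol2_odd (beta : R) (ell j : R -> R) (y : R) :
  sol2 beta ell j (- y) = - sol2 beta ell j y.
Proof. unfold sol2. rewrite sol1_even, Rabs_Ropp. unfold Rdiv. rewrite Rinv_opp. ring. Qed.

Lemma profile_exponent_ge0 (beta mu c K : R) (ell j : R -> R) (y : R) :
  0 < beta -> profile beta mu c K ell j -> 0 < y -> 0 <= exponent beta ell j y.
Proof.
  intros Hb HP Hy. unfold exponent.
  apply Rmult_le_pos; [left; now apply Rinv_0_lt_compat|].
  assert (0 <= psi (ell y)) by (apply psi_ge0; left; eapply profile_ell_pos; eassumption).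
  assert (0 <= j y) by (eapply profile_j_ge0; eassumption). lra.
Qed.

Lemma profile_exponent_le (beta mu c K : R) (ell j : R -> R) (y : R) :
  0 < beta -> profile beta mu c K ell j -> 0 < y ->
  exponent beta ell j y <= 2 * c / beta * Rpower y mu.
Proof.
  intros Hb HP Hy. unfold exponent.
  replace (2 * c / beta * Rpower y mu)
    with (/ beta * (c * Rpower y mu + c * Rpower y mu)) by (field; lra).
  apply Rmult_le_compat_l; [left; now apply Rinv_0_lt_compat|].
  generalize (psi_le (ell y)) (profile_ell_le _ _ _ _ _ _ HP y Hy)
    (profile_j_le _ _ _ _ _ _ HP y Hy). lra.
Qed.

(** This is the equation [beta * ds/dtau = - s * (1 - f')], from which [u] was
    obtained by integration. *)
Lemma exponent_derive (beta mu c K : R) (ell j : R -> R) (y : R) :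
  0 < beta -> profile beta mu c K ell j -> 0 < y ->
  is_derive (exponent beta ell j) y ((1 - sol1 beta ell j y) / (beta * y)).
Proof.
  intros Hb HP Hy.
  assert (He := profile_ell_derive _ _ _ _ _ _ HP y Hy).
  assert (Hj := profile_j_derive _ _ _ _ _ _ HP y Hy).
  unfold exponent at 1. unfold psi at 1. auto_derive.
  - repeat split; eexists; eassumption.
  - rewrite (is_derive_unique (fun x : R => ell x) _ _ He), (is_derive_unique (fun x : R => j x) _ _ Hj).
    unfold sol1. rewrite Rabs_pos_eq by lra. unfold psi. field. lra.
Qed.

Lemma sol_derive_pos (beta mu c K : R) (ell j : R -> R) (y : R) :
  0 < beta -> profile beta mu c K ell j -> 0 < y ->
  is_derive (sol ell) y (sol1 beta ell j y).
Proof.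
  intros Hb HP Hy.
  assert (He := profile_ell_derive _ _ _ _ _ _ HP y Hy).
  apply (is_derive_ext_loc (fun x => x * exp (- ell x))).
  - apply (filter_imp (fun x => 0 < x)); [|now apply locally_pos].
    intros x Hx. unfold sol. now rewrite Rabs_pos_eq by lra.
  - auto_derive; [repeat split; eexists; eassumption|].
    rewrite (is_derive_unique (fun x : R => ell x) _ _ He).
    unfold sol1. rewrite Rabs_pos_eq by lra. unfold psi. field. lra.
Qed.

Lemma sol1_derive_pos (beta mu c K : R) (ell j : R -> R) (y : R) :
  0 < beta -> profile beta mu c K ell j -> 0 < y ->
  is_derive (sol1 beta ell j) y (sol2 beta ell j y).
Proof.
  intros Hb HP Hy.
  assert (He := profile_ell_derive _ _ _ _ _ _ HP y Hy).
  assert (Hu := exponent_derive _ _ _ _ _ _ y Hb HP Hy).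
  apply (is_derive_ext_loc
           (fun x => exp (- ell x) * (exp (- exponent beta ell j x) - (1 - beta)) / beta)).
  - apply (filter_imp (fun x => 0 < x)); [|now apply locally_pos].
    intros x Hx. unfold sol1. now rewrite Rabs_pos_eq by lra.
  - auto_derive; [repeat split; eexists; eassumption|].
    rewrite (is_derive_unique (fun x : R => ell x) _ _ He).
    rewrite (is_derive_unique (fun x : R => exponent beta ell j x) _ _ Hu).
    unfold sol2. unfold sol1. rewrite Rabs_pos_eq by lra. unfold psi at 2. unfold psi at 1. field. lra.
Qed.

Lemma sol2_continuous_pos (beta mu c K : R) (ell j : R -> R) (y : R) :
  0 < beta -> profile beta mu c K ell j -> 0 < y -> continuous (sol2 beta ell j) y.
Proof.
  intros Hb HP Hy.
  assert (He := profile_ell_derive _ _ _ _ _ _ HP y Hy).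
  assert (Hu := exponent_derive _ _ _ _ _ _ y Hb HP Hy).
  assert (H1 := sol1_derive_pos _ _ _ _ _ _ y Hb HP Hy).
  apply (continuous_ext_loc _ (fun x =>
    - (psi (exponent beta ell j x) / beta * sol1 beta ell j x
       + exp (- ell x) * exp (- exponent beta ell j x)
         * (1 - sol1 beta ell j x) / beta ^ 2) / x)).
  - apply (filter_imp (fun x => 0 < x)); [|now apply locally_pos].
    intros x Hx. unfold sol2. now rewrite Rabs_pos_eq by lra.
  - apply (ex_derive_continuous (K := R_AbsRing) (V := R_NormedModule)).
    unfold psi. auto_derive. repeat split; try (eexists; eassumption). lra.
Qed.

(** [1 - f' = psi(ell) + g * psi(u) / beta], and both [ell] and [u] are
    [O(y^mu)]. *)
Lemma sol1_bounds (beta mu c K : R) (ell j : R -> R) (y : R) :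
  0 < beta < 1 -> profile beta mu c K ell j -> y <> 0 ->
  0 <= 1 - sol1 beta ell j y <= c * (1 + 2 / beta ^ 2) * Rpower (Rabs y) mu /\
  Rabs (sol1 beta ell j y) <= / beta.
Proof.
  intros Hb HP Hy. unfold sol1. set (x := Rabs y).
  assert (Hx : 0 < x) by now apply Rabs_pos_lt.
  assert (Hib : 0 < / beta) by now apply Rinv_0_lt_compat.
  assert (Hl := profile_ell_pos _ _ _ _ _ _ HP x Hx).
  assert (Hl2 := profile_ell_le _ _ _ _ _ _ HP x Hx).
  assert (Hu := profile_exponent_ge0 _ _ _ _ _ _ x (proj1 Hb) HP Hx).
  assert (Hu2 := profile_exponent_le _ _ _ _ _ _ x (proj1 Hb) HP Hx).
  set (u := exponent beta ell j x) in *. set (l := ell x) in *.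
  assert (Hg := exp_opp_bounds l (Rlt_le _ _ Hl)). assert (Hs := exp_opp_bounds u Hu).
  assert (E : 1 - exp (- l) * (exp (- u) - (1 - beta)) / beta
              = psi l + exp (- l) * (psi u * / beta)) by (unfold psi; field; lra).
  rewrite E.
  assert (H1 := psi_ge0 l ltac:(lra)). assert (H2 := psi_le l).
  assert (H3 := psi_ge0 u Hu). assert (H4 := psi_le u).
  assert (H5 : 0 <= psi u * / beta) by (apply Rmult_le_pos; lra).
  assert (H6 : psi u * / beta <= 2 * c / beta ^ 2 * Rpower x mu).
  { replace (2 * c / beta ^ 2 * Rpower x mu)
      with ((2 * c / beta * Rpower x mu) * / beta) by (field; lra).
    apply Rmult_le_compat_r; lra. }
  split; [split|].
  - nra.
  - replace (c * (1 + 2 / beta ^ 2) * Rpower x mu)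
      with (c * Rpower x mu + 2 * c / beta ^ 2 * Rpower x mu) by (field; lra).
    nra.
  - unfold Rdiv. rewrite Rabs_mult, (Rabs_pos_eq (/ beta)) by lra.
    rewrite <- (Rmult_1_l (/ beta)) at 2. apply Rmult_le_compat_r; [lra|].
    apply Rabs_le. nra.
Qed.

(** Each term of [y * f''] contains a factor [psi u] or [1 - f'], which are
    [O(y^mu)]; dividing by [y] leaves [O(y^(mu - 1))]. *)
Lemma sol2_bound (beta mu c K : R) (ell j : R -> R) :
  0 < beta < 1 -> 0 < c -> profile beta mu c K ell j ->
  exists K', 0 <= K' /\
    forall y, y <> 0 -> Rabs (sol2 beta ell j y) <= K' * Rpower (Rabs y) (mu - 1).
Proof.
  intros Hb Hc HP.
  assert (Hib : 0 < / beta) by now apply Rinv_0_lt_compat.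
  assert (Hib2 : 0 < / beta ^ 2) by (apply Rinv_0_lt_compat; nra).
  (* The summands bound the two terms of sol2, using |f'| <= 1 / beta in the first. *)
  exists (2 * c * / beta ^ 2 * / beta + c * (1 + 2 / beta ^ 2) * / beta ^ 2). split.
  { apply Rplus_le_le_0_compat; repeat apply Rmult_le_pos; lra. }
  intros y Hy. destruct (sol1_bounds _ _ _ _ _ _ y Hb HP Hy) as [H1 H2].
  unfold sol2. set (F := sol1 beta ell j y) in *. set (x := Rabs y) in *.
  assert (Hx : 0 < x) by now apply Rabs_pos_lt.
  assert (Hl := profile_ell_pos _ _ _ _ _ _ HP x Hx).
  assert (Hu := profile_exponent_ge0 _ _ _ _ _ _ x (proj1 Hb) HP Hx).
  assert (Hu2 := profile_exponent_le _ _ _ _ _ _ x (proj1 Hb) HP Hx).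
  set (u := exponent beta ell j x) in *. set (l := ell x) in *.
  assert (Hg := exp_opp_bounds l (Rlt_le _ _ Hl)). assert (Hs := exp_opp_bounds u Hu).
  rewrite Rabs_div by exact Hy. fold x. rewrite Rabs_Ropp.
  apply (Rmult_le_reg_r x); [exact Hx|].
  match goal with |- Rabs ?n / x * x <= _ => replace (Rabs n / x * x) with (Rabs n) by (field; lra) end.
  rewrite (Rmult_assoc _ (Rpower x (mu - 1)) x), (Rmult_comm (Rpower x (mu - 1))),
    <- Rpower_pred by exact Hx.
  eapply Rle_trans; [apply Rabs_triang|]. rewrite Rmult_plus_distr_r.
  apply Rplus_le_compat.
  - rewrite Rabs_mult.
    replace (2 * c * / beta ^ 2 * / beta * Rpower x mu)
      with ((2 * c / beta * Rpower x mu) / beta * / beta) by (field; lra).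
    assert (H3 := psi_ge0 u Hu). assert (H4 := psi_le u).
    apply Rmult_le_compat; try apply Rabs_pos; [|exact H2].
    unfold Rdiv at 1. rewrite Rabs_pos_eq by (apply Rmult_le_pos; lra).
    apply Rmult_le_compat_r; lra.
  - unfold Rdiv at 1. rewrite Rabs_pos_eq.
    + rewrite (Rmult_assoc (c * _)), (Rmult_comm (/ beta ^ 2)), <- Rmult_assoc.
      apply Rmult_le_compat_r; [lra|].
      assert (0 <= exp (- l) * exp (- u) <= 1) by nra. nra.
    + repeat apply Rmult_le_pos; lra.
Qed.

Lemma sol1_at_0 (beta mu c K : R) (ell j : R -> R) :
  0 < beta -> profile beta mu c K ell j -> sol1 beta ell j 0 = 1.
Proof.
  intros Hb HP. unfold sol1, exponent. rewrite Rabs_R0.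
  rewrite (profile_ell_0 _ _ _ _ _ _ HP), (profile_j_0 _ _ _ _ _ _ HP), psi_0.
  rewrite Rplus_0_r, Rmult_0_r, Ropp_0, exp_0. field. lra.
Qed.

Lemma sol2_at_0 (beta : R) (ell j : R -> R) : sol2 beta ell j 0 = 0.
Proof. unfold sol2. unfold Rdiv. rewrite Rinv_0. ring. Qed.

(** Oddness reduces [y < 0] to [y > 0]. At [0] the bound
    [|f y - y| <= c * |y| * |y|^mu] is used. *)
Lemma sol_derive (beta mu c K : R) (ell j : R -> R) (y : R) :
  0 < beta < 1 -> 1 < mu -> 0 < c -> profile beta mu c K ell j ->
  is_derive (sol ell) y (sol1 beta ell j y).
Proof.
  intros Hb Hm Hc HP. destruct (Rtotal_order y 0) as [Hy | [-> | Hy]].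
  - apply (is_derive_ext (fun x => - sol ell (- x))).
    { intros x. rewrite sol_odd. apply Ropp_involutive. }
    replace (sol1 beta ell j y) with (opp (- sol1 beta ell j (- y)))
      by (rewrite sol1_even; apply Ropp_involutive).
    apply (is_derive_opp (fun x => sol ell (- x))).
    apply is_derive_reflect. eapply sol_derive_pos; [apply Hb | exact HP | lra].
  - rewrite (sol1_at_0 _ _ _ _ _ _ (proj1 Hb) HP).
    apply (flat_derive_at_0 _ _ c mu); [lra | lra |].
    intros y Hy. assert (Hx := Rabs_pos_lt y Hy). unfold sol.
    rewrite Rmult_0_l, Rminus_0_r, Rmult_1_l.
    replace (y * exp (- ell (Rabs y)) - y) with (- (y * psi (ell (Rabs y))))
      by (unfold psi; ring).
    rewrite Rabs_Ropp, Rabs_mult.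
    assert (Hl := profile_ell_pos _ _ _ _ _ _ HP _ Hx).
    assert (Hl2 := profile_ell_le _ _ _ _ _ _ HP _ Hx).
    rewrite (Rabs_pos_eq (psi _)) by (apply psi_ge0; lra).
    rewrite Rmult_comm, <- Rmult_assoc, (Rmult_comm c), Rmult_assoc, Rmult_comm.
    apply Rmult_le_compat_l; [lra|].
    generalize (psi_le (ell (Rabs y))); lra.
  - eapply sol_derive_pos; [apply Hb | exact HP | exact Hy].
Qed.

Lemma sol1_derive (beta mu c K : R) (ell j : R -> R) (y : R) :
  0 < beta < 1 -> 1 < mu -> 0 < c -> profile beta mu c K ell j ->
  is_derive (sol1 beta ell j) y (sol2 beta ell j y).
Proof.
  intros Hb Hm Hc HP. destruct (Rtotal_order y 0) as [Hy | [-> | Hy]].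
  - apply (is_derive_ext (fun x => sol1 beta ell j (- x))).
    { intros x. apply sol1_even. }
    replace (sol2 beta ell j y) with (- sol2 beta ell j (- y)) by (rewrite sol2_odd; ring).
    apply is_derive_reflect. eapply sol1_derive_pos; [apply Hb | exact HP | lra].
  - rewrite sol2_at_0.
    apply (flat_derive_at_0 _ _ (c * (1 + 2 / beta ^ 2)) (mu - 1)); [lra | |].
    { apply Rmult_le_pos; [lra|]. assert (0 < / beta ^ 2) by (apply Rinv_0_lt_compat; nra).
      unfold Rdiv. lra. }
    intros y Hy. rewrite (sol1_at_0 _ _ _ _ _ _ (proj1 Hb) HP).
    rewrite <- Rpower_pred by now apply Rabs_pos_lt.
    destruct (sol1_bounds _ _ _ _ _ _ y Hb HP Hy) as [H1 _].
    rewrite Rabs_left1 by lra. lra.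
  - eapply sol1_derive_pos; [apply Hb | exact HP | exact Hy].
Qed.

Lemma sol2_continuous (beta mu c K : R) (ell j : R -> R) (y : R) :
  0 < beta < 1 -> 1 < mu -> 0 < c -> profile beta mu c K ell j ->
  continuous (sol2 beta ell j) y.
Proof.
  intros Hb Hm Hc HP. destruct (Rtotal_order y 0) as [Hy | [-> | Hy]].
  - apply (continuous_ext (fun x => opp (sol2 beta ell j (- x)))).
    { intros x. rewrite sol2_odd. apply Ropp_involutive. }
    apply (continuous_opp (V := R_NormedModule)).
    apply (continuous_comp (fun x => - x) (sol2 beta ell j)).
    + apply (continuous_opp (V := R_NormedModule)), continuous_id.
    + eapply sol2_continuous_pos; [apply Hb | exact HP | lra].
  - destruct (sol2_bound _ _ _ _ _ _ Hb Hc HP) as [K' [HK' H]].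
    apply (flat_continuous_at_0 _ K' (mu - 1)); [lra | exact HK' | apply sol2_at_0 | exact H].
  - eapply sol2_continuous_pos; [apply Hb | exact HP | exact Hy].
Qed.

(** Off the origin the equation is an identity between rational functions of [g],
    [s] and [y]; at the origin both sides vanish. *)
Lemma sol_similarity_ode (alpha mu c K : R) (ell j : R -> R) :
  0 < alpha < 1 -> 1 < mu -> 0 < c -> profile (1 - alpha) mu c K ell j ->
  similarity_ode alpha (1 - alpha) (sol ell).
Proof.
  intros Ha Hm Hc HP. set (beta := 1 - alpha) in *.
  assert (Hb : 0 < beta < 1) by (unfold beta; lra).
  assert (D1 : forall y, is_derive (sol ell) y (sol1 beta ell j y)) by (intros y; eapply sol_derive; eassumption).
  assert (D2 : forall y, is_derive (sol1 beta ell j) y (sol2 beta ell j y)) by (intros y; eapply sol1_derive; eassumption).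
  assert (E1 : forall y, Derive (sol ell) y = sol1 beta ell j y) by (intros y; apply is_derive_unique, D1).
  assert (D2' : forall y, is_derive (Derive_n (sol ell) 1) y (sol2 beta ell j y)).
  { intros y. apply (is_derive_ext (sol1 beta ell j)); [|apply D2]. intros x. symmetry. apply E1. }
  assert (E2 : forall y, Derive_n (sol ell) 2 y = sol2 beta ell j y)
    by (intros y; apply is_derive_unique, D2').
  split; [split|].
  - intros [|[|[|k]]] y Hk; [exact I | eexists; apply D1 | eexists; apply D2' | lia].
  - intros y. apply (continuous_ext (sol2 beta ell j)).
    + intros x. symmetry. apply E2.
    + eapply sol2_continuous; eassumption.
  - intros y. rewrite E1, E2. destruct (Req_dec y 0) as [-> | Hy].
    + unfold sol. ring.
    + unfold sol2, sol1, sol, psi. replace alpha with (1 - beta) by (unfold beta; ring).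
      field. lra.
Qed.

(** * Asymptotics *)

Lemma sol_pos (ell : R -> R) (y : R) : 0 < y -> 0 < sol ell y.
Proof. intros Hy. apply Rmult_lt_0_compat; [exact Hy | apply exp_pos]. Qed.

(** [exp (- ell) = 1 - ell + O(ell^2)] and [ell = c * y^mu + O(y^(2 mu))]. *)
Lemma sol_expansion (beta mu c K : R) (ell j : R -> R) :
  0 < beta -> 0 < mu -> 0 < c -> 0 <= K -> profile beta mu c K ell j ->
  is_domin (at_right 0) (fun y : R => Rpower y (mu + 1))
    (fun y : R => sol ell y - (y + - c * Rpower y (mu + 1))).
Proof.
  intros Hb Hm Hc HK HP e.
  destruct (Rpower_small mu (e / (c ^ 2 + K)) Hm) as [d [Hd Hs]].
  { apply Rdiv_lt_0_compat; [apply cond_pos | nra]. }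
  exists (mkposreal d Hd). intros y Hball Hy.
  assert (Hyd : y < d).
  { unfold ball in Hball; simpl in Hball; unfold AbsRing_ball, minus, plus, opp, abs in Hball;
    simpl in Hball. apply Rabs_def2 in Hball. lra. }
  specialize (Hs y (conj Hy Hyd)).
  unfold norm; simpl; unfold abs; simpl.
  rewrite (Rpower_pred y (mu + 1) Hy). replace (mu + 1 - 1) with mu by ring.
  assert (Hl := profile_ell_pos _ _ _ _ _ _ HP y Hy).
  assert (Hl2 := profile_ell_le _ _ _ _ _ _ HP y Hy).
  assert (Hl3 := profile_ell_expansion _ _ _ _ _ _ HP y Hy).
  assert (HPos : 0 < Rpower y mu) by apply exp_pos.
  set (P := Rpower y mu) in *.
  unfold sol. rewrite (Rabs_pos_eq y) by lra. set (l := ell y) in *.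
  replace (y * exp (- l) - (y + - c * (y * P))) with (y * ((l - psi l) - (l - c * P)))
    by (unfold psi; ring).
  rewrite !Rabs_mult, (Rabs_pos_eq y) by lra. rewrite (Rabs_pos_eq P) by lra.
  apply (Rmult_lt_compat_r (c ^ 2 + K)) in Hs; [|nra].
  replace (e / (c ^ 2 + K) * (c ^ 2 + K)) with (pos e) in Hs by (field; nra).
  assert (H1 := psi_le l). assert (H2 := psi_ge_quadratic l ltac:(lra)).
  assert (H3 : Rabs (l - psi l - (l - c * P)) <= (c ^ 2 + K) * P ^ 2).
  { eapply Rle_trans; [apply Rabs_triang|]. rewrite Rabs_Ropp.
    rewrite (Rabs_pos_eq (l - psi l)) by lra. nra. }
  replace (e * (y * P)) with (y * (e * P)) by ring.
  apply Rmult_le_compat_l; [lra|]. eapply Rle_trans; [exact H3|]. nra.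
Qed.

(** For [k = ell - ln y / beta] one has [y * k' = - exp (- u) / beta <= 0]. Let
    [dl = psi (ell 1)]. For [y >= 1], [y * j' = psi(ell) >= dl] and [u >= j / beta],
    so [k'] is at least the derivative of [exp (- j / beta) / dl]. Hence
    [k - exp (- j / beta) / dl] is nondecreasing, which bounds [k] from below. *)
Lemma profile_ell_log (beta mu c K : R) (ell j : R -> R) :
  0 < beta -> profile beta mu c K ell j ->
  exists l, (forall y, 1 <= y -> l <= ell y - ln y / beta) /\
    forall e, 0 < e -> exists M, 1 <= M /\ forall y, M <= y -> ell y - ln y / beta < l + e.
Proof.
  intros Hb HP.
  assert (Hib : 0 < / beta) by now apply Rinv_0_lt_compat.
  assert (Hu : forall y, 0 < y -> 0 <= exponent beta ell j y)
    by (intros y Hy; eapply profile_exponent_ge0; eassumption).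
  assert (Hk : forall y, 0 < y ->
    is_derive (fun y => ell y - ln y / beta) y (- exp (- exponent beta ell j y) / (beta * y))).
  { intros y Hy. assert (He := profile_ell_derive _ _ _ _ _ _ HP y Hy).
    auto_derive; [split; [eexists; exact He | split; auto]|].
    rewrite (is_derive_unique (fun x : R => ell x) _ _ He). unfold psi. field. lra. }
  set (dl := psi (ell 1)).
  assert (Hdl : 0 < dl) by (apply psi_gt0, (profile_ell_pos _ _ _ _ _ _ HP); lra).
  assert (Hell : forall y, 1 <= y -> dl <= psi (ell y)).
  { intros y Hy. apply psi_increasing.
    apply (derive_nonneg_le ell (fun y => psi (exponent beta ell j y) / (beta * y)) 1 y Hy).
    intros x Hx. split; [apply (profile_ell_derive _ _ _ _ _ _ HP); lra|].
    apply Rdiv_le_0_compat; [apply psi_ge0, Hu; lra | apply Rmult_lt_0_compat; lra]. }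
  apply (monotone_limit _ (ell 1 - ln 1 / beta - / dl * exp (- (/ beta * j 1)))).
  - intros x y Hxy. apply Ropp_le_cancel.
    apply (derive_nonneg_le (fun y => - (ell y - ln y / beta))
             (fun y => - (- exp (- exponent beta ell j y) / (beta * y)))); [lra|].
    intros t Ht. split.
    + apply (is_derive_opp (fun y => ell y - ln y / beta)). apply Hk. lra.
    + replace (- (- exp (- exponent beta ell j t) / (beta * t)))
        with (exp (- exponent beta ell j t) / (beta * t)) by (field; lra).
      apply Rdiv_le_0_compat; [left; apply exp_pos | apply Rmult_lt_0_compat; lra].
  - intros y Hy.
    assert (H : ell 1 - ln 1 / beta - / dl * exp (- (/ beta * j 1))
                <= ell y - ln y / beta - / dl * exp (- (/ beta * j y))).
    { apply (derive_nonneg_le (fun y => ell y - ln y / beta - / dl * exp (- (/ beta * j y)))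
               (fun y => - exp (- exponent beta ell j y) / (beta * y)
                  + / dl * (exp (- (/ beta * j y)) * (/ beta * (psi (ell y) / y)))) 1 y Hy).
      intros x Hx.
      assert (Hj := profile_j_derive _ _ _ _ _ _ HP x ltac:(lra)).
      specialize (Hk x ltac:(lra)). specialize (Hell x ltac:(lra)).
      split.
      - replace (- exp (- exponent beta ell j x) / (beta * x)
                  + / dl * (exp (- (/ beta * j x)) * (/ beta * (psi (ell x) / x))))
          with (minus (- exp (- exponent beta ell j x) / (beta * x))
                  (- (/ dl * (exp (- (/ beta * j x)) * (/ beta * (psi (ell x) / x))))))
          by (unfold minus, plus, opp; simpl; ring).
        apply (is_derive_minus (fun y => ell y - ln y / beta)); [exact Hk|].
        auto_derive; [eexists; exact Hj|].
        rewrite (is_derive_unique (fun x : R => j x) _ _ Hj). ring.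
      - assert (Hle : exp (- exponent beta ell j x) <= exp (- (/ beta * j x))).
        { assert (0 < / beta * psi (ell x)) by (apply Rmult_lt_0_compat; lra).
          left. apply exp_increasing. unfold exponent. lra. }
        replace (- exp (- exponent beta ell j x) / (beta * x)
                  + / dl * (exp (- (/ beta * j x)) * (/ beta * (psi (ell x) / x))))
          with ((exp (- (/ beta * j x)) * psi (ell x) - dl * exp (- exponent beta ell j x))
                / (dl * beta * x)) by (field; lra).
        apply Rdiv_le_0_compat; [|repeat apply Rmult_lt_0_compat; lra].
        generalize (exp_pos (- exponent beta ell j x)). nra. }
    assert (0 < / dl * exp (- (/ beta * j y)))
      by (apply Rmult_lt_0_compat; [now apply Rinv_0_lt_compat | apply exp_pos]).
    lra.
Qed.

(** With [k = ell - ln y / beta] decreasing to [l],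
    [f = y^(1 - 1/beta) * exp (- k)] and [1 - 1/beta = - alpha/beta], so
    [C0 = exp (- l)]. *)
Lemma sol_decay (alpha mu c K : R) (ell j : R -> R) :
  0 < alpha < 1 -> profile (1 - alpha) mu c K ell j ->
  exists C0, 0 < C0 /\ decay_at_infinity alpha C0 (sol ell).
Proof.
  intros Ha HP.
  destruct (profile_ell_log (1 - alpha) _ _ _ _ _ ltac:(lra) HP) as [l [Hl Hlim]].
  assert (E : forall y, 1 <= y -> sol ell y
    = exp (- l) * Rpower y (- (alpha / (1 - alpha)))
      * exp (- (ell y - ln y / (1 - alpha) - l))).
  { intros y Hy. unfold sol, Rpower. rewrite (Rabs_pos_eq y) by lra.
    rewrite <- (exp_ln y) at 1 by lra. rewrite <- !exp_plus. f_equal. field. lra. }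
  exists (exp (- l)). split; [apply exp_pos|]. split.
  - intros e. destruct (Hlim e (cond_pos e)) as [M [HM HM']]. exists M. intros y Hy.
    unfold norm, minus, plus, opp; simpl; unfold abs; simpl.
    rewrite E by lra. specialize (HM' y ltac:(lra)). specialize (Hl y ltac:(lra)).
    set (t := ell y - ln y / (1 - alpha) - l).
    set (g := exp (- l) * Rpower y (- (alpha / (1 - alpha)))).
    replace (g + - (g * exp (- t))) with (psi t * g) by (unfold psi; ring).
    rewrite Rabs_mult. apply Rmult_le_compat_r; [apply Rabs_pos|].
    assert (Ht : 0 <= t <= e) by (unfold t; lra).
    rewrite Rabs_pos_eq by now apply psi_ge0. generalize (psi_le t). lra.
  - intros S [e He].
    destruct (Rpower_small (alpha / (1 - alpha)) (e * exp l)) as [d [Hd Hs]].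
    { apply Rdiv_lt_0_compat; lra. }
    { apply Rmult_lt_0_compat; [apply cond_pos | apply exp_pos]. }
    exists (Rmax 1 (/ d)). intros y Hy.
    assert (H1 : 1 < y) by (eapply Rle_lt_trans; [apply Rmax_l | exact Hy]).
    assert (H2 : / d < y) by (eapply Rle_lt_trans; [apply Rmax_r | exact Hy]).
    assert (Hpos := sol_pos ell y ltac:(lra)).
    apply He; [|exact Hpos].
    unfold ball; simpl; unfold AbsRing_ball, minus, plus, opp, abs; simpl.
    rewrite Ropp_0, Rplus_0_r, Rabs_pos_eq by lra.
    rewrite E by lra.
    assert (Hy' : 0 < / y < d).
    { split; [apply Rinv_0_lt_compat; lra|]. rewrite <- (Rinv_inv d).
      apply Rinv_lt_contravar; [|exact H2].
      apply Rmult_lt_0_compat; [now apply Rinv_0_lt_compat | lra]. }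
    specialize (Hs _ Hy').
    replace (Rpower (/ y) (alpha / (1 - alpha))) with (Rpower y (- (alpha / (1 - alpha)))) in Hs.
    2: { unfold Rpower. rewrite ln_Rinv by lra. f_equal. ring. }
    specialize (Hl y ltac:(lra)).
    assert (Hx := exp_opp_bounds (ell y - ln y / (1 - alpha) - l) ltac:(lra)).
    assert (Hr : 0 < Rpower y (- (alpha / (1 - alpha)))) by apply exp_pos.
    assert (HL := exp_pos (- l)).
    apply (Rmult_lt_compat_l (exp (- l))) in Hs; [|exact HL].
    replace (exp (- l) * (e * exp l)) with (pos e) in Hs.
    2: { replace (exp (- l) * (e * exp l)) with (e * (exp (- l) * exp l)) by ring.
         rewrite <- exp_plus, Rplus_opp_l, exp_0. ring. }
    eapply Rle_lt_trans; [|exact Hs].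
    rewrite <- (Rmult_1_r (exp (- l) * Rpower y (- (alpha / (1 - alpha))))) at 2.
    apply Rmult_le_compat_l; [apply Rmult_le_pos; lra | apply Hx].
Qed.

(** * Existence *)

(** Up to the factor [2 * (1 - alpha)^2], [m_+ - 1] is [1 + sqrt (1 + 4 * (1 - alpha)^2)],
    and the square root is larger than [1]. *)
Lemma m_plus_spec (alpha : R) : 0 < alpha < 1 ->
  1 < m_plus alpha - 1 /\
  (1 - alpha) ^ 2 * (m_plus alpha - 1) ^ 2 = m_plus alpha - 1 + 1.
Proof.
  intros Ha. unfold m_plus.
  replace ((2 * alpha ^ 2 - 4 * alpha + 3) ^ 2 - 4 * (1 - alpha) ^ 4)
    with (1 + 4 * (1 - alpha) ^ 2) by ring.
  set (s := sqrt (1 + 4 * (1 - alpha) ^ 2)).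
  assert (Hs2 : s * s = 1 + 4 * (1 - alpha) ^ 2) by (apply sqrt_sqrt; nra).
  assert (Hs : 1 < s).
  { unfold s. rewrite <- sqrt_1 at 1. apply sqrt_lt_1; nra. }
  replace ((2 * alpha ^ 2 - 4 * alpha + 3 + s) / (2 * (1 - alpha) ^ 2) - 1)
    with ((1 + s) / (2 * (1 - alpha) ^ 2)) by (field; lra).
  split.
  - apply (Rmult_lt_reg_r (2 * (1 - alpha) ^ 2)); [nra|].
    replace ((1 + s) / (2 * (1 - alpha) ^ 2) * (2 * (1 - alpha) ^ 2)) with (1 + s)
      by (field; lra). nra.
  - replace ((1 - alpha) ^ 2 * ((1 + s) / (2 * (1 - alpha) ^ 2)) ^ 2)
      with ((1 + 2 * s + s * s) / (4 * (1 - alpha) ^ 2)) by (field; lra).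
    rewrite Hs2. field. lra.
Qed.

Theorem theorem3p1 :
  forall alpha beta : R, 0 < alpha < 1 -> beta = 1 - alpha ->
  forall A : R, A < 0 ->
  exists f : R -> R,
    similarity_ode alpha beta f /\
    antisymmetric f /\
    (forall y : R, 0 < y -> 0 < f y) /\
    expansion_at_origin alpha A f /\
    exists C0 : R, 0 < C0 /\ decay_at_infinity alpha C0 f.
Proof.
  intros alpha beta Ha -> A HA.
  destruct (m_plus_spec alpha Ha) as [Hm E].
  destruct (profile_exists (1 - alpha) (m_plus alpha - 1) (- A)) as [ell [j [K [HK HP]]]];
    [lra | exact Hm | exact E | lra |].
  exists (sol ell). split; [|split; [|split; [|split]]].
  - apply (sol_similarity_ode alpha (m_plus alpha - 1) (- A) K ell j Ha Hm ltac:(lra) HP).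
  - split; [unfold sol; ring | apply sol_odd].
  - apply sol_pos.
  - unfold expansion_at_origin.
    replace (m_plus alpha) with (m_plus alpha - 1 + 1) by ring.
    rewrite <- (Ropp_involutive A).
    apply (sol_expansion (1 - alpha) _ _ K ell j); lra || exact HP.
  - exact (sol_decay _ _ _ _ _ _ Ha HP).
Qed.
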